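(* For any Banach space $X$ with $\dim X\ge 2$, $$H(X)^2\le \frac{1}{2}G_L(X).$$
   Context: $S_X=\{x\in X:\|x\|=1\}$ denotes the unit sphere of $X$. For a Banach space $X$ with $\dim X\ge 2$, define $$H(X)=\sup\{\min\{\|x+y\|,\|2x-y\|\}: x,\,y,\,x-y\in S_X\},$$ $$G_L(X)=\sup\{\|x+y\|^{2}+\|2x-y\|^{2}: x,y\in X,\ \|x\|=\|y\|=\|x-y\|=1\}.$$ *)

(* Defs.v *)
From mathcomp Require Import all_boot all_order all_algebra.
From mathcomp Require Import all_classical all_reals all_analysis.
Set Implicit Arguments.
Unset Strict Implicit.
Unset Printing Implicit Defensive.
Import Order.TTheory GRing.Theory Num.Theory.
Import numFieldNormedType.Exports.
Local Open Scope classical_set_scope.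
Local Open Scope ring_scope.

(* [X] may be infinite-dimensional, so vectType's [free] is not available. *)
Definition dim_ge2 (R : realType) (X : completeNormedModType R) : Prop :=
  exists u v : X, forall a b : R, a *: u + b *: v = 0 -> a = 0 /\ b = 0.

Definition unit_sphere (R : realType) (X : completeNormedModType R) : set X :=
  [set x : X | `|x| = 1].

(* [sup] is the real supremum, which is 0 on sets that are empty or not
   bounded above. Neither case occurs below when [dim_ge2 X]: the sets are
   nonempty because, for x on the unit sphere S, the map y |-> `|x - y| takes
   the values 0 and 2 on the connected set S, hence also 1; they are bounded
   because `|x + y| <= 2 and `|2 *: x - y| <= `|x| + `|x - y| = 2. *)
Definition H_const (R : realType) (X : completeNormedModType R) : R :=
  sup [set r : R | exists x y : X,
    [/\ unit_sphere x, unit_sphere y, unit_sphere (x - y) &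
        r = Num.min `|x + y| `|2%:R *: x - y|]].

Definition GL_const (R : realType) (X : completeNormedModType R) : R :=
  sup [set r : R | exists x y : X,
    [/\ `|x| = 1, `|y| = 1, `|x - y| = 1 &
        r = `|x + y| ^+ 2 + `|2%:R *: x - y| ^+ 2]].

(* Main.v *)
Require Import Defs.
From mathcomp Require Import all_boot all_order all_algebra.
From mathcomp Require Import all_classical all_reals all_analysis.
From mathcomp Require Import lra.
Import Order.TTheory GRing.Theory Num.Theory.
Import numFieldNormedType.Exports.
Local Open Scope ring_scope.

(** For nonnegative a and b, the square of min(a, b) is at most both a^2 and
    b^2, hence at most their mean. With a = |x + y| and b = |2x - y| this
    ([min_sqr_le_mean]) bounds the square of each competitor for H(X) by half
    of the competitor for G_L(X) given by the same pair (x, y), so by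
    G_L(X) / 2. Each competitor for H(X) is thus at most the square root of
    G_L(X) / 2, and so is their supremum H(X); squaring, which is monotone on
    nonnegative numbers, gives the inequality.

    Because the suprema are real-valued, bounding a member of the family that
    defines G_L(X) by G_L(X) needs that family to be bounded above, which is
    [GL_term_le]. *)

Lemma sup_nonneg_ge0 (R : realType) (A : set R) :
  (forall r, A r -> 0 <= r) -> 0 <= sup A.
Proof.
move=> A_ge0; have [supA|/sup_out -> //] := pselect (has_sup A).
have [[r Ar] ubA] := supA.
by apply: le_trans (A_ge0 r Ar) _; exact: ub_le_sup.
Qed.

(** The nonnegativity of M covers the empty set, whose real supremum is 0. *)
Lemma sup_le_nonneg_ub (R : realType) (A : set R) (M : R) :
  0 <= M -> ubound A M -> sup A <= M.
Proof.
move=> M_ge0 ubM; have [->|A_neq0] := eqVneq A set0; first by rewrite sup0.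
by apply: ge_sup => //; exact/set0P.
Qed.

Lemma min_sqr_le_mean (R : realFieldType) (a b : R) :
  0 <= a -> 0 <= b -> Num.min a b ^+ 2 <= 1 / 2%:R * (a ^+ 2 + b ^+ 2).
Proof. by move=> a0 b0; case: (leP a b) => ab; nra. Qed.

(** Both norms are at most 2 by the triangle inequality, the second one because
    2x - y = x + (x - y). *)
Lemma GL_term_le (R : realType) (X : normedModType R) (x y : X) :
  `|x| = 1 -> `|y| = 1 -> `|x - y| = 1 ->
  `|x + y| ^+ 2 + `|2%:R *: x - y| ^+ 2 <= 8%:R.
Proof.
move=> nx ny nxy.
have le_sum : `|x + y| <= 2%:R by have := ler_normD x y; rewrite nx ny; lra.
have le_diff : `|2%:R *: x - y| <= 2%:R.
  by rewrite scaler_nat mulr2n -addrA; have := ler_normD x (x - y);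
    rewrite nx nxy; lra.
have := normr_ge0 (x + y); have := normr_ge0 (2%:R *: x - y).
by nra.
Qed.

Lemma GL_term_le_GL_const (R : realType) (X : completeNormedModType R)
    (x y : X) :
  `|x| = 1 -> `|y| = 1 -> `|x - y| = 1 ->
  `|x + y| ^+ 2 + `|2%:R *: x - y| ^+ 2 <= GL_const X.
Proof.
move=> nx ny nxy; apply: ub_le_sup; last by exists x, y.
by exists 8%:R => _ [u [v [nu nv nuv ->]]]; exact: GL_term_le.
Qed.

Lemma GL_const_ge0 (R : realType) (X : completeNormedModType R) :
  0 <= GL_const X.
Proof.
by apply: sup_nonneg_ge0 => _ [x [y [_ _ _ ->]]]; rewrite addr_ge0 ?sqr_ge0.
Qed.

Lemma H_const_ge0 (R : realType) (X : completeNormedModType R) :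
  0 <= H_const X.
Proof.
by apply: sup_nonneg_ge0 => _ [x [y [_ _ _ ->]]]; rewrite le_min !normr_ge0.
Qed.

Theorem proposition3p10 (R : realType) (X : completeNormedModType R)
    (hdim : dim_ge2 X) :
  H_const X ^+ 2 <= 1 / 2%:R * GL_const X.
Proof.
have half_GL_ge0 : 0 <= 1 / 2%:R * GL_const X.
  by rewrite mulr_ge0 ?GL_const_ge0.
suff H_le : H_const X <= Num.sqrt (1 / 2%:R * GL_const X).
  rewrite -(sqr_sqrtr half_GL_ge0) ler_sqr // nnegrE ?sqrtr_ge0 //.
  exact: H_const_ge0.
apply: sup_le_nonneg_ub; rewrite ?sqrtr_ge0 // => _ [x [y [nx ny nxy ->]]].
rewrite -[leLHS]ger0_norm ?le_min ?normr_ge0 // -sqrtr_sqr ler_wsqrtr //.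
apply: le_trans (min_sqr_le_mean _ _ _ (normr_ge0 _) (normr_ge0 _)) _.
by rewrite ler_wpM2l //; exact: GL_term_le_GL_const.
Qed.
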